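(* Let $\lambda>0$ and let $Q=(Q_j)_{j\ge1}$ be a probability measure on $\mathbb{N}=\{1,2,\ldots\}$ such that $$L:=\sup\Big\{\tau\ge 1:\ \sum_{j\ge1}j^{\tau}Q_j<\infty\Big\}>1$$ ($L=\infty$ allowed). Write $q_r=\sum_{j\ge1}j^rQ_j$ for $r\in\mathbb{N}$. Let $Z$ be a random variable with the compound Poisson distribution $\mathrm{CP}(\lambda,Q)$. If $K>0$ and $f:\mathbb{Z}_+\to\mathbb{R}$ is $K$-Lipschitz, then for every positive integer $n<L$ and every $t>0$, $$\Pr\big\{|f(Z)-E[f(Z)]|>t\big\}\;\le\;A\cdot B^n\cdot t^{-n},$$ where $$A=\exp\Big\{\lambda\sum_{r=1}^{n}\binom{n}{r}q_rK^r-\lambda n\log K\Big\},\qquad B=2|f(0)|+2K\lambda q_1+1.$$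
   Context: $\mathbb{Z}_+=\{0,1,2,\ldots\}$. For $\lambda>0$ and a probability measure $Q=(Q_j)_{j\ge1}$ on $\mathbb{N}=\{1,2,\ldots\}$ (with $Q_j=Q(\{j\})$), $\mathrm{CP}(\lambda,Q)$ is the law on $\mathbb{Z}_+$ of the random sum $\sum_{i=1}^{W}X_i$ (equal to $0$ when $W=0$), where $W\sim\mathrm{Poisson}(\lambda)$ and $X_1,X_2,\ldots$ are i.i.d. with law $Q$, independent of $W$. A function $f:\mathbb{Z}_+\to\mathbb{R}$ is $K$-Lipschitz if $|f(j+1)-f(j)|\le K$ for all $j\in\mathbb{Z}_+$. *)

(* Defs.v *)
From HB Require Import structures.
From mathcomp Require Import all_boot all_order all_algebra.
From mathcomp Require Import all_classical all_reals all_analysis.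

Set Implicit Arguments.
Unset Strict Implicit.
Unset Printing Implicit Defensive.

Import Order.TTheory GRing.Theory Num.Theory.
Import numFieldNormedType.Exports.

Local Open Scope classical_set_scope.
Local Open Scope ring_scope.

(* The family is indexed by an arbitrary, possibly infinite type I: the product
   rule is required for every finite subfamily. *)
Definition mutually_independent (R : realType) (d d' : measure_display)
    (T : measurableType d) (T' : measurableType d') (P : probability T R)
    (I : eqType) (X : I -> {RV P >-> T'}) : Prop :=
  forall (J : seq I) (A : I -> set T'), uniq J ->
    (forall i, measurable (A i)) ->
    (P (\bigcap_(i in [set` J]) (X i @^-1` A i)) =
     \prod_(i <- J) P (X i @^-1` A i))%E.

(* mu is the law of X 0 + ... + X (W - 1). The joint independence of W and the
   sequence X is that of the family indexed by option nat, with W at None. The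
   second argument of poisson_prob is not used by its definition. *)
Definition is_compound_poisson (R : realType) (lambda : R)
    (Q : probability nat R) (mu : probability nat R) : Prop :=
  exists (d : measure_display) (S : measurableType d) (P : probability S R)
         (W : {RV P >-> nat}) (X : nat -> {RV P >-> nat}),
    [/\ forall A, distribution P W A = poisson_prob lambda 0%N A,
        forall i A, distribution P (X i) A = Q A,
        mutually_independent (fun i : option nat => if i is Some k then X k else W)
      & forall A, mu A = P [set s | A (\sum_(i < W s) X i s)%N]].

Definition moment (R : realType) (Q : probability nat R) (tau : R) : \bar R :=
  (\sum_(1 <= j <oo) (j%:R `^ tau)%:E * Q [set j])%E.

Definition moment_order (R : realType) (Q : probability nat R) : \bar R :=
  ereal_sup [set tau%:E | tau in [set tau : R | 1 <= tau /\ (moment Q tau < +oo)%E]].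

(* Only used for r < moment_order Q, where the moment is finite. *)
Definition qmoment (R : realType) (Q : probability nat R) (r : nat) : R :=
  fine (moment Q r%:R).

Definition nat_lipschitz (R : realType) (K : R) (f : nat -> R) : Prop :=
  forall j : nat, `|f j.+1 - f j| <= K.

(* Main.v *)
(* Since f is K-Lipschitz, |f Z - E f Z| <= K Z + K lambda q_1 <= G, where
   G = c + K Z and c = 1 + K lambda q_1, so by Markov's inequality it is enough to
   bound the moment E[G^n]. Stein's identity E[Z g(Z)] = lambda E[X g(Z + X)]
   with g(z) = (c + K z)^k expresses E[G^(k+1)] through lower moments of G; as
   b = E G = 1 + 2 K lambda q_1 is at least 1, an induction on k gives
   E[G^n] <= b^n exp(lambda sum_(r >= 2) C(n, r) q_r K^r). The missing term r = 1
   is n q_1 K >= n K >= n log K, which yields the constant A.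
   Moments are truncated to finite sums, so that no integrability is needed
   before the bound is established. *)
Require Import Defs.
From HB Require Import structures.
From mathcomp Require Import all_boot all_order all_algebra.
From mathcomp Require Import all_classical all_reals all_analysis.
From mathcomp Require Import ring lra measurable_realfun.

Set Implicit Arguments.
Unset Strict Implicit.
Unset Printing Implicit Defensive.

Import Order.TTheory GRing.Theory Num.Theory.
Import numFieldNormedType.Exports.

Local Open Scope classical_set_scope.
Local Open Scope ring_scope.

(** * Triangular sums and the recursion for truncated moments *)

Lemma sum_triangle (R : nmodType) (F : nat -> nat -> R) (N : nat) :
  \sum_(0 <= s < N) \sum_(0 <= j < s.+1) F j (s - j)%N
    = \sum_(0 <= j < N) \sum_(0 <= i < N - j) F j i.
Proof.
elim: N => [|N IHN]; first by rewrite !big_nil.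
rewrite big_nat_recr//= IHN [RHS]big_nat_recr//= subSn// subnn big_nat1.
rewrite big_nat_recr//= subnn addrA; congr (_ + _).
rewrite -big_split/= big_nat_cond [RHS]big_nat_cond; apply: eq_bigr => j.
by case/andP=> /andP[_ /ltnW jN] _; rewrite subSn// big_nat_recr.
Qed.

(** Enlarging the triangle i + j < N to a square lets a truncated double sum factor into a moment in
    j times a moment in i, at the price of an inequality. *)
Lemma ler_sum_triangle (R : numDomainType) (F : nat -> nat -> R) (N : nat) :
  (forall i j, 0 <= F i j) ->
  \sum_(0 <= s < N) \sum_(0 <= j < s.+1) F j (s - j)%N
    <= \sum_(0 <= j < N) \sum_(0 <= i < N) F j i.
Proof.
move=> F_ge0; rewrite sum_triangle; apply: ler_sum => j _.
by rewrite [leRHS](@big_cat_nat _ _ _ (N - j))/= ?leq_subr// lerDl sumr_ge0.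
Qed.

(** For [mu] the point masses of Z this is E[G^k; Z < N] with G = c + K Z. *)
Definition truncated_moment (R : pzRingType) (c K : R) (mu : nat -> R)
    (N k : nat) : R :=
  \sum_(0 <= s < N) (c + K * s%:R) ^+ k * mu s.

(* Panjer's recursion [mu_rec] is Stein's identity
   [E[Z g(Z)] = lambda E[X g(Z + X)]] on point masses; here it is applied to
   [g(z) = (c + K z)^k]. *)
Lemma panjer_moment_step (R : numDomainType) (lambda c K : R) (q mu : nat -> R)
    (k N : nat) :
  0 <= lambda -> 0 <= c -> 0 <= K ->
  (forall j, 0 <= q j) -> (forall j, 0 <= mu j) ->
  (forall s, s%:R * mu s =
     lambda * \sum_(0 <= j < s.+1) j%:R * q j * mu (s - j)%N) ->
  let M := truncated_moment c K mu N in
  M k.+1 <= c * M k + \sum_(0 <= r < k.+1) 'C(k, r)%:R *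
    (lambda * K ^+ r.+1 * \sum_(0 <= j < N) j%:R ^+ r.+1 * q j) * M (k - r)%N.
Proof.
move=> l0 c0 K0 q0 mu0 mu_rec /=.
set M := truncated_moment c K mu N.
(* One factor c + K s is split off: c gives [c * M k], and s [mu s] is replaced by means of
   [mu_rec]; writing s = (s - j) + j prepares the separation of variables. *)
have -> : M k.+1 = c * M k +
    K * lambda * \sum_(0 <= s < N) \sum_(0 <= j < s.+1)
      (j%:R * q j) * (mu (s - j)%N * (c + K * (s - j)%:R + K * j%:R) ^+ k).
  rewrite /M /truncated_moment !mulr_sumr -big_split/=; apply: eq_bigr => s _.
  rewrite exprS !mulrDl -mulrA; congr (_ + _).
  transitivity (K * (c + K * s%:R) ^+ k * (s%:R * mu s)); first by ring.
  rewrite mu_rec !mulr_sumr big_nat_cond [RHS]big_nat_cond.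
  apply: eq_bigr => j /andP[/andP[_ js] _].
  have -> : c + K * (s - j)%:R + K * j%:R = c + K * s%:R.
    by rewrite -addrA -mulrDr -natrD subnK.
  ring.
rewrite lerD2l; apply: (@le_trans _ _ (K * lambda *
   \sum_(0 <= j < N) \sum_(0 <= i < N)
      (j%:R * q j) * (mu i * (c + K * i%:R + K * j%:R) ^+ k))).
  apply: ler_wpM2l; first exact: mulr_ge0.
  apply: (@ler_sum_triangle _ (fun j i =>
    (j%:R * q j) * (mu i * (c + K * i%:R + K * j%:R) ^+ k))) => j i.
  by rewrite !mulr_ge0// exprn_ge0// !addr_ge0// mulr_ge0.
rewrite le_eqVlt; apply/orP; left; apply/eqP.
(* Binomial expansion in powers of K j; the factors K and j already present raise both exponents
   from r to r + 1. *)
transitivity (\sum_(0 <= r < k.+1) \sum_(0 <= j < N) \sum_(0 <= i < N)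
    'C(k, r)%:R * (lambda * K ^+ r.+1 * (j%:R ^+ r.+1 * q j)) *
    ((c + K * i%:R) ^+ (k - r) * mu i)); last first.
  apply: eq_bigr => r _; under [LHS]eq_bigr => j _ do rewrite -mulr_sumr.
  by rewrite -mulr_suml -mulr_sumr -mulr_sumr.
rewrite mulr_sumr [RHS]exchange_big/=; apply: eq_bigr => j _.
rewrite mulr_sumr [RHS]exchange_big/=; apply: eq_bigr => i _.
rewrite exprDn [RHS]big_mkord !mulr_sumr; apply: eq_bigr => r _.
rewrite exprMn -mulr_natl !exprS; ring.
Qed.

(* The r = 1 term of the exponent is absent: it is accounted for by the factor
   [b ^+ k]. *)
Lemma moment_recursion_bound (R : realType) (b : R) (kappa m : nat -> R)
    (n : nat) :
  1 <= b -> (forall r, 0 <= kappa r) -> m 0%N <= 1 ->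
  (forall k, (k < n)%N -> m k.+1 <= b * m k +
     \sum_(1 <= r < k.+1) 'C(k, r)%:R * kappa r.+1 * m (k - r)%N) ->
  forall k, (k <= n)%N ->
    m k <= b ^+ k * expR (\sum_(2 <= r < k.+1) 'C(k, r)%:R * kappa r).
Proof.
move=> b1 kap0 m01 m_rec.
pose E k := \sum_(2 <= r < k.+1) 'C(k, r)%:R * kappa r.
have b0 : 0 <= b by lra.
(* Pascal's rule; the top term of the first sum vanishes because C(k, k + 1) = 0. *)
have E_step k : E k.+1 = E k + \sum_(1 <= r < k.+1) 'C(k, r)%:R * kappa r.+1.
  rewrite /E big_add1/=.
  under eq_bigr => r _ do rewrite binS natrD mulrDl.
  rewrite big_split/=; congr (_ + _).
  have -> : \sum_(1 <= r < k.+1) 'C(k, r.+1)%:R * kappa r.+1 =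
            \sum_(2 <= r < k.+2) 'C(k, r)%:R * kappa r.
    by rewrite [RHS]big_add1.
  case: k => [|k]; first by rewrite !big_geq.
  by rewrite big_nat_recr//= bin_small// mul0r addr0.
have E_mono i j : (i <= j)%N -> E i <= E j.
  elim: j => [|j IHj]; first by rewrite leqn0 => /eqP ->.
  rewrite leq_eqVlt ltnS => /orP[/eqP -> //|/IHj /le_trans]; apply.
  by rewrite E_step lerDl sumr_ge0// => r _; rewrite mulr_ge0.
elim/ltn_ind => -[|k] IHk kn; first by rewrite expr0 mul1r big_geq// expR0.
rewrite -/(E k.+1) (le_trans (m_rec _ kn))//.
pose S := \sum_(1 <= r < k.+1) 'C(k, r)%:R * kappa r.+1.
(* The induction closes through 1 + S <= exp S, where S = E (k + 1) - E k. *)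
apply: (@le_trans _ _ (b ^+ k.+1 * expR (E k) * (1 + S))); last first.
  rewrite -mulrA E_step -/S expRD; apply: ler_wpM2l; first exact: exprn_ge0.
  by apply: ler_wpM2l (expR_ge1Dx _); exact: expR_ge0.
rewrite mulrDr mulr1; apply: lerD.
  by rewrite exprS -mulrA; apply: ler_wpM2l => //; apply: IHk => //; exact: ltnW.
rewrite /S mulr_sumr big_nat_cond [leRHS]big_nat_cond.
apply: ler_sum => r /andP[/andP[r0 rk] _].
rewrite [leRHS]mulrC; apply: ler_wpM2l; first exact: mulr_ge0.
apply: le_trans (IHk _ _ _) _; first by rewrite ltnS leq_subr.
  by rewrite (leq_trans (leq_subr _ _))// ltnW.
(* Since 1 <= b, b^(k - r) <= b^(k + 1); [E] is nondecreasing. *)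
rewrite -/(E (k - r)%N); apply: ler_pM; rewrite ?exprn_ge0 ?expR_ge0//.
  by apply: ler_weXn2l => //; rewrite (leq_trans (leq_subr _ _)).
by rewrite ler_expR E_mono// leq_subr.
Qed.

(** * Point masses of the compound Poisson law and Panjer's recursion *)

(** Compare coefficients in X (p^(w + 1))' = (w + 1) (X p') p^w; as s < N, the truncation of p does
    not affect them. *)
Lemma coef_poly_exp_panjer (R : comNzRingType) (q : nat -> R) (N w s : nat) :
  (s < N)%N ->
  s%:R * ((\poly_(j < N) q j) ^+ w.+1)`_s =
  w.+1%:R * \sum_(0 <= j < s.+1)
    j%:R * q j * ((\poly_(j < N) q j) ^+ w)`_(s - j).
Proof.
case: s => [|s] sN; first by rewrite big_nat1 !mul0r mulr0.
set p := \poly_(j < N) q j.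
have -> : s.+1%:R * (p ^+ w.+1)`_s.+1 = ((p ^+ w.+1)^`())`_s.
  by rewrite coef_deriv mulr_natl.
rewrite deriv_exp coefMn coefM/= -[LHS]mulr_natl; congr (_ * _).
rewrite big_nat_recl//= !mul0r add0r big_mkord.
apply: eq_bigr => j _; rewrite subSS; congr (_ * _).
have jN : (j.+1 < N)%N by rewrite (leq_trans _ sN)// !ltnS -ltnS.
by rewrite coef_deriv coef_poly jN mulr_natl.
Qed.

Lemma measurable_sumn (d : measure_display) (T : measurableType d) (I : Type)
    (s : seq I) (Y : I -> T -> nat) :
  (forall i, measurable_fun setT (Y i)) ->
  measurable_fun setT (fun x => \sum_(i <- s) Y i x)%N.
Proof.
move=> mY; elim: s => [|i s IHs].
  by under eq_fun do rewrite big_nil; exact: measurable_cst.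
by under eq_fun do rewrite big_cons; exact: measurable_fun_addn.
Qed.

(* Convolution powers of the common law are coefficients of powers of its
   generating polynomial, whose truncation at [N] does not matter below [N]. The
   events indexed by [J] make the induction on [s] go through. *)
Lemma independent_sum_pmf (R : realType) (d : measure_display)
    (S : measurableType d) (P : probability S R) (I : eqType)
    (Y : I -> {RV P >-> nat}) (Q : probability nat R) (N : nat) (s : seq I) :
  mutually_independent Y ->
  (forall i A, i \in s -> distribution P (Y i) A = Q A) ->
  forall (J : seq I) (A : I -> set nat) (v : nat), uniq (s ++ J) -> (v < N)%N ->
  P (\bigcap_(i in [set` J]) (Y i @^-1` A i) `&`
     [set x | (\sum_(i <- s) Y i x)%N = v]) =
  (P (\bigcap_(i in [set` J]) (Y i @^-1` A i)) *
   (((\poly_(j < N) fine (Q [set j])) ^+ size s)`_v)%:E)%E.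
Proof.
move=> indep; elim: s => [|i s IHs] lawY J A v uJ vN.
  rewrite expr0 coef1; case: eqP => [->|v0].
    by rewrite mule1; congr (P _); apply/seteqP; split=> x/=; rewrite big_nil//; case.
  rewrite mule0 [X in P X](_ : _ = set0) ?measure0//.
  by apply/seteqP; split=> x//=; rewrite big_nil => -[_ /esym].
set E := \bigcap_(i in [set` J]) _; set p := \poly_(j < N) _.
have [iJ isN] : i \notin J /\ i \notin s.
  by move: uJ; rewrite /= mem_cat negb_or -andbA => /and3P[].
have uJ' : uniq (s ++ i :: J).
  by rewrite (perm_uniq (_ : perm_eq _ (i :: s ++ J)))// perm_catC/= perm_cons perm_catC.
(* Fixing the value j of [Y i] moves [i] from the summed indices to the indices of events, so that
   the induction hypothesis applies to [i :: J]. *)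
pose A' j := fun k => if k == i then [set j] else A k.
have EE j : E `&` (Y i @^-1` [set j]) =
    \bigcap_(k in [set` i :: J]) (Y k @^-1` A' j k).
  apply/seteqP; split=> x.
    move=> [Ex Yx] k /=; rewrite inE => /predU1P[->|kJ].
      by rewrite /A' eqxx.
    rewrite /A'; case: eqP => [kE|_]; last exact: Ex.
    by rewrite kE.
  move=> H; split; last first.
    by have := H i; rewrite /A' eqxx; apply; rewrite /= mem_head.
  move=> k/= kJ; have := H k; rewrite /A' /=.
  rewrite ifN; last by apply: contraNneq iJ => <-.
  by apply; rewrite inE kJ orbT.
have PE j : P (E `&` (Y i @^-1` [set j])) = (P E * Q [set j])%E.
  rewrite EE indep//; last first.
    by move: uJ'; rewrite cat_uniq => /and3P[].
  rewrite big_cons {1}/A' eqxx (_ : P (Y i @^-1` [set j]) = Q [set j]); last first.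
    by rewrite -(lawY i) ?mem_head.
  rewrite muleC; congr (_ * _)%E.
  rewrite /E indep//; last first.
    by move: uJ; rewrite cat_uniq => /and3P[].
  apply: eq_big_seq => k kJ; rewrite /A' ifN//.
  by apply: contraNneq iJ => <-.
have mE : measurable E.
  by apply: fin_bigcap_measurable => // k _; exact: measurable_funPTI.
have mS u : measurable [set x | (\sum_(k <- s) Y k x)%N = u].
  rewrite -[X in measurable X]setTI.
  suff mf : measurable_fun setT (fun x => \sum_(k <- s) Y k x)%N.
    by apply: (mf _ [set u]).
  exact: measurable_sumn.
(* Splitting by the value j <= v of [Y i] produces the Cauchy product of coefficients. *)
pose F j := (E `&` (Y i @^-1` [set j])) `&`
  [set x | (\sum_(k <- s) Y k x)%N = (v - j)%N].
rewrite [X in P X](_ : _ = \big[setU/set0]_(j < v.+1) F j); last first.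
  rewrite -bigcup_mkord; apply/seteqP; split=> x.
    move=> [Ex] /=; rewrite big_cons => Sx; exists (Y i x) => /=.
      by rewrite ltnS -Sx leq_addr.
    by split=> //=; rewrite -Sx addKn.
  move=> [j /= jv] [[Ex Yx] /= Sx]; split=> //=.
  by rewrite big_cons Yx Sx subnKC.
rewrite measure_bigsetU//; last 2 first.
- move=> j; apply: measurableI => //; apply: measurableI => //.
  exact: measurable_funPTI.
- by move=> j k _ _ [x [[[_ <-] _] [[_ <-] _]]].
transitivity (\sum_(j < v.+1) (P E * (p`_j * (p ^+ size s)`_(v - j))%:E))%E.
  apply: eq_bigr => j _.
  have jN : (j < N)%N by rewrite (leq_ltn_trans _ vN)// -ltnS.
  rewrite /F EE; apply: (etrans (IHs _ (i :: J) (A' j) (v - j)%N _ _)) => //.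
  - by move=> k B ks; apply: lawY; rewrite inE ks orbT.
  - by rewrite (leq_ltn_trans (leq_subr _ _)).
  - rewrite -EE PE -muleA EFinM; congr (_ * (_ * _))%E.
    by rewrite coef_poly jN fineK// fin_num_measure.
rewrite exprS coefM -(@fineK _ (P E)) ?fin_num_measure//.
by rewrite -EFinM mulr_sumr -sumEFin.
Qed.

Lemma poly_nneg_exp_coef_ge0 (R : numDomainType) (q : nat -> R) (N w s : nat) :
  (forall j, 0 <= q j) -> 0 <= ((\poly_(j < N) q j) ^+ w)`_s.
Proof.
move=> q0; elim: w s => [|w IHw] s; first by rewrite expr0 coef1 ler0n.
rewrite exprS coefM sumr_ge0// => j _; rewrite mulr_ge0//.
by rewrite coef_poly; case: ifP.
Qed.

(** Split by the value w of W: independence factors each piece into a Poisson weight and a w-fold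
    convolution power of [Q]. *)
Lemma compound_poisson_pmf (R : realType) (lambda : R)
    (Q mu : probability nat R) (N s : nat) :
  0 < lambda -> is_compound_poisson lambda Q mu -> (s < N)%N ->
  mu [set s] = (\sum_(0 <= w <oo) (poisson_pmf lambda w *
    ((\poly_(j < N) fine (Q [set j])) ^+ w)`_s)%:E)%E.
Proof.
move=> l0 [d [S [P [W [X [W_law X_law indep mu_law]]]]]] sN.
rewrite mu_law.
pose Y (i : option nat) := if i is Some k then X k else W.
pose F w := (W @^-1` [set w]) `&`
  [set x | (\sum_(i <- map Some (iota 0 w)) Y i x)%N = s].
rewrite [X in P X](_ : _ = \bigcup_w F w); last first.
  have FE w x : (\sum_(i < w) X i x)%N = (\sum_(i <- map Some (iota 0 w)) Y i x)%N.
    by rewrite big_map -[X in iota _ X]subn0 big_mkord.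
  apply/seteqP; split=> x /=; first by rewrite FE => ?; exists (W x).
  by move=> [w _ [/= <-]]; rewrite FE.
have mF w : measurable (F w).
  apply: measurableI; first exact: measurable_funPTI.
  rewrite -[X in measurable X]setTI.
  by apply: (@measurable_sumn _ _ _ _ Y _ measurableT [set s]) => //.
rewrite measure_semi_bigcup//; last 2 first.
- by move=> i j _ _ [x [[/= <- _] [/= <- _]]].
- exact: bigcupT_measurable.
apply: eq_eseriesr => w _.
(* The event W = w becomes an intersection over the single index [None], the form that
   [independent_sum_pmf] expects. *)
rewrite /F (_ : W @^-1` [set w] =
    \bigcap_(i in [set` [:: None]]) (Y i @^-1` [set w])); last first.
  by rewrite set_cons1 bigcap_set1.
apply: etrans (@independent_sum_pmf _ _ _ P _ Y Q N _ indep _ _ _ _ _ sN) _.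
- by move=> i A /mapP[k _ ->]; exact: X_law.
- rewrite cat_uniq map_inj_uniq ?iota_uniq/=; last by move=> ? ? [].
  by rewrite orbF andbT; apply/negP => /mapP[].
rewrite set_cons1 bigcap_set1 size_map size_iota EFinM; congr (_ * _)%E.
rewrite -[LHS]/(distribution P W [set w]) W_law /poisson_prob l0.
by rewrite esum_set1// lee_fin poisson_pmf_ge0.
Qed.

(** The factor w + 1 from [coef_poly_exp_panjer] is absorbed by the Poisson weights p through (w +
    1) p(w + 1) = lambda p(w); then sum over w. *)
Lemma compound_poisson_panjer (R : realType) (lambda : R)
    (Q mu : probability nat R) (s : nat) :
  0 < lambda -> is_compound_poisson lambda Q mu ->
  s%:R * fine (mu [set s]) =
  lambda * \sum_(0 <= j < s.+1)
    j%:R * fine (Q [set j]) * fine (mu [set (s - j)%N]).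
Proof.
move=> l0 mu_cp.
pose q j := fine (Q [set j]); have q0 j : 0 <= q j by exact: fine_ge0.
pose p := \poly_(j < s.+1) q j.
have p0 w k : 0 <= (p ^+ w)`_k by exact: poly_nneg_exp_coef_ge0.
have pmf0 w : 0 <= poisson_pmf lambda w by exact: poisson_pmf_ge0.
have fin k : mu [set k] \is a fin_num by rewrite fin_num_measure.
apply: EFin_inj; rewrite EFinM fineK//.
rewrite (compound_poisson_pmf l0 mu_cp (ltnSn s)) -nneseriesZl; last first.
  by move=> w _; rewrite lee_fin mulr_ge0.
rewrite nneseries_recl//; last by move=> w _; rewrite -EFinM lee_fin !mulr_ge0.
(* The term w = 0 vanishes: its coefficient is zero unless s = 0, and then the factor s is zero. The
   series is then shifted by one. *)
rewrite -EFinM expr0 coef1 [s%:R * _](_ : _ = 0) ?add0e; last first.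
  by case: (s) => [|k]; rewrite ?mul0r// !mulr0.
rewrite -(@nneseries_addn _ _ 1); last first.
  by move=> w; rewrite -EFinM lee_fin !mulr_ge0.
pose G (j : nat) w : \bar R :=
  ((lambda * (j%:R * q j))%:E * (poisson_pmf lambda w * (p ^+ w)`_(s - j))%:E)%E.
transitivity (\sum_(0 <= w <oo) \sum_(0 <= j < s.+1) G j w)%E.
  apply: eq_eseriesr => w _; rewrite addn1 sumEFin -EFinM; congr EFin.
  rewrite mulrCA coef_poly_exp_panjer// mulrA.
  have -> : poisson_pmf lambda w.+1 * w.+1%:R = lambda * poisson_pmf lambda w.
    rewrite /poisson_pmf l0 factS natrM exprS; field.
    by rewrite nat1r !pnatr_eq0 -lt0n fact_gt0.
  rewrite mulr_sumr; apply: eq_bigr => j _; rewrite -/(q _) -/p; ring.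
rewrite nneseries_sum; last first.
  by move=> j w _; rewrite /G -EFinM lee_fin !mulr_ge0// ltW.
rewrite mulr_sumr -sumEFin big_nat_cond [RHS]big_nat_cond.
apply: eq_bigr => j /andP[/andP[_ js] _].
rewrite nneseriesZl; last by move=> w _; rewrite lee_fin mulr_ge0.
rewrite -(compound_poisson_pmf l0 mu_cp) ?ltnS ?leq_subr//.
by rewrite -[in LHS](fineK (fin _)) -EFinM -[in LHS]mulrA.
Qed.

(** * Moments of [Q] and integrals of functions of an integer-valued variable *)

(** The supremum supplies some tau > r with a finite moment, and j^r <= j^tau for j >= 1. *)
Lemma moment_lty (R : realType) (Q : probability nat R) (r : nat) :
  (0 < r)%N -> (r%:R%:E < moment_order Q)%E -> (moment Q r%:R < +oo)%E.
Proof.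
move=> r0 /ereal_sup_gt[_ [tau [tau1 Qtau] <-]]; rewrite lte_fin => r_tau.
apply: le_lt_trans Qtau; apply: lee_nneseries => j.
  by move=> _ _; rewrite mule_ge0// lee_fin powR_ge0.
move=> _; rewrite lee_wpmul2r// lee_fin.
(* The comparison at j = 0 relies on r > 0, since 0 to the power 0 is 1. *)
case: j => [|j].
  by rewrite !powR0 ?pnatr_eq0 -?lt0n// gt_eqF// (lt_le_trans ltr01).
by rewrite ler_powR ?ler1n// ltW.
Qed.

Lemma sum_pmf_le1 (R : realType) (mu : probability nat R) (N : nat) :
  \sum_(0 <= s < N) fine (mu [set s]) <= 1.
Proof.
rewrite -lee_fin -sumEFin big_mkord.
under eq_bigr => s _ do rewrite fineK ?fin_num_measure//.
rewrite -[leLHS](@measure_bigsetU _ _ _ mu (fun s => [set s]))//.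
  exact: probability_le1.
by move=> i j _ _ [x [/= -> ->]].
Qed.

Lemma truncated_moment_le_qmoment (R : realType) (Q : probability nat R)
    (r N : nat) :
  (moment Q r.+1%:R < +oo)%E ->
  \sum_(0 <= j < N) j%:R ^+ r.+1 * fine (Q [set j]) <= qmoment Q r.+1.
Proof.
move=> Qr.
have t0 j : (0 <= (j%:R `^ r.+1%:R)%:E * Q [set j])%E.
  by rewrite mule_ge0// lee_fin powR_ge0.
rewrite -lee_fin /qmoment fineK; last first.
  by rewrite ge0_fin_numE// nneseries_ge0.
(* The term j = 0 vanishes because the exponent [r.+1] is positive, so the sum may start at 1 as in
   [moment]. *)
apply: (@le_trans _ _ (\sum_(1 <= j < N) ((j%:R `^ r.+1%:R)%:E * Q [set j])))%E.
  case: N => [|N]; first by rewrite !big_geq.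
  rewrite big_nat_recl// expr0n mul0r add0r big_add1/= -sumEFin.
  apply: lee_sum => j _.
  by rewrite powR_mulrn// EFinM fineK// fin_num_measure.
exact: nneseries_lim_ge.
Qed.

Lemma measurable_nat_rv_comp (R : realType) (d : measure_display)
    (T : measurableType d) (P : probability T R) (Z : {RV P >-> nat})
    (h : nat -> R) (D : set T) :
  measurable_fun D (fun w => (h (Z w))%:E).
Proof.
apply/measurable_EFinP; apply: (@measurable_funS _ _ _ _ setT) => //.
exact: (@measurableT_comp _ _ _ _ _ _ h).
Qed.

Lemma ge0_integral_nat_rv (R : realType) (d : measure_display)
    (T : measurableType d) (P : probability T R) (Z : {RV P >-> nat})
    (h : nat -> R) :
  (forall k, 0 <= h k) ->
  (\int[P]_w (h (Z w))%:E =
   \sum_(0 <= k <oo) (h k * fine (distribution P Z [set k]))%:E)%E.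
Proof.
move=> h0.
have -> : [set: T] = \bigcup_k (Z @^-1` [set k]).
  by apply/seteqP; split=> // x _; exists (Z x).
have mZ k : measurable (Z @^-1` [set k]) by exact: measurable_funPTI.
rewrite ge0_integral_bigcup//; last 3 first.
- exact: measurable_nat_rv_comp.
- by move=> x _; rewrite lee_fin.
- by move=> i j _ _ [x [/= <- <-]].
apply: eq_eseriesr => k _.
under eq_integral => x /set_mem/= -> do [].
by rewrite integral_cst// EFinM fineK// fin_num_measure.
Qed.

(** As [Q] does not charge 0, its mean dominates its total mass. This later gives log K <= q_1 K. *)
Lemma qmoment1_ge1 (R : realType) (Q : probability nat R) :
  Q [set 0%N] = 0%E -> (moment Q 1 < +oo)%E -> 1 <= qmoment Q 1.
Proof.
move=> Q0 Q1.
have t0 j : (0 <= (j%:R `^ 1%:R)%:E * Q [set j])%E.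
  by rewrite mule_ge0// lee_fin powR_ge0.
rewrite -lee_fin /qmoment fineK; last first.
  by rewrite ge0_fin_numE// nneseries_ge0.
have <- : Q [set: nat] = 1%E by exact: probability_setT.
have -> : [set: nat] = \bigcup_k [set k].
  by apply/seteqP; split=> // k _; exists k.
rewrite measure_semi_bigcup//; last by move=> i j _ _ [x [/= -> ->]].
rewrite [leLHS]nneseries_recl//= Q0 add0e /moment.
rewrite eseries_cond [leRHS]eseries_cond.
apply: lee_nneseries => // j; rewrite /= => j0.
by rewrite powR_mulrn// expr1 lee_pemull// lee_fin ler1n.
Qed.

(** * Moment bounds for the compound Poisson law *)

Lemma compound_poisson_truncated_moment_le (R : realType) (lambda K : R)
    (Q mu : probability nat R) (n N : nat) :
  0 < lambda -> 0 <= K -> is_compound_poisson lambda Q mu ->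
  (forall r, (0 < r <= n)%N -> (moment Q r%:R < +oo)%E) ->
  truncated_moment (1 + K * lambda * qmoment Q 1) K
    (fun s => fine (mu [set s])) N n <=
  (1 + 2 * K * lambda * qmoment Q 1) ^+ n *
    expR (\sum_(2 <= r < n.+1) 'C(n, r)%:R * (lambda * K ^+ r * qmoment Q r)).
Proof.
move=> l0 K0 mu_cp Q_fin.
have qm0 r : 0 <= qmoment Q r.
  by apply: fine_ge0; apply: nneseries_ge0 => j _ _; rewrite mule_ge0// lee_fin powR_ge0.
have l0' := ltW l0.
set c := 1 + K * lambda * qmoment Q 1.
have c0 : 0 <= c by rewrite addr_ge0// !mulr_ge0.
set M := truncated_moment c K _ N.
have M0 k : 0 <= M k.
  apply: sumr_ge0 => s _; rewrite mulr_ge0 ?fine_ge0//.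
  by rewrite exprn_ge0// addr_ge0// mulr_ge0.
apply: (@moment_recursion_bound _ _ (fun r => lambda * K ^+ r * qmoment Q r) M n)
  => //.
- by rewrite lerDl !mulr_ge0.
- by move=> r; rewrite !mulr_ge0// exprn_ge0.
- by rewrite /M /truncated_moment; under eq_bigr do rewrite expr0 mul1r; exact: sum_pmf_le1.
move=> k kn.
apply: le_trans (@panjer_moment_step _ lambda c K (fun j => fine (Q [set j]))
  _ k N l0' c0 K0 _ _ _) _.
- by move=> j; exact: fine_ge0.
- by move=> j; exact: fine_ge0.
- by move=> s; exact: compound_poisson_panjer.
rewrite -/M big_nat_recl// subn0 bin0 mul1r.
(* The r = 0 term of the recursion is at most lambda K q_1 [M k]; joined to [c * M k] it gives the
   base c + lambda K q_1 of the bound. *)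
rewrite (_ : 1 + 2 * K * lambda * qmoment Q 1 = c + lambda * K * qmoment Q 1); last first.
  by rewrite /c; ring.
rewrite [(c + _) * _]mulrDl -[leRHS]addrA lerD2l big_add1/= expr1.
have qle r : (r < n)%N ->
    \sum_(0 <= j < N) j%:R ^+ r.+1 * fine (Q [set j]) <= qmoment Q r.+1.
  by move=> rn; apply: truncated_moment_le_qmoment; apply: Q_fin.
apply: lerD.
  by rewrite ler_wpM2r// ler_wpM2l ?mulr_ge0// qle// (leq_ltn_trans _ kn).
rewrite big_nat_cond [leRHS]big_nat_cond.
apply: ler_sum => r /andP[/andP[_ rk] _].
have lK0 : 0 <= lambda * K ^+ r.+2 by rewrite mulr_ge0// exprn_ge0.
rewrite ler_wpM2r// ler_wpM2l// ler_wpM2l//.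
by rewrite qle// (leq_trans _ kn)// ltnS.
Qed.

(** The integral is the limit of the truncated moments, so a bound uniform in [N] passes to it. *)
Lemma integral_pow_le (R : realType) (d : measure_display)
    (T : measurableType d) (P : probability T R) (Z : {RV P >-> nat})
    (c K B : R) (n : nat) :
  0 <= c -> 0 <= K ->
  (forall N, truncated_moment c K
     (fun s => fine (distribution P Z [set s])) N n <= B) ->
  (\int[P]_w ((c + K * (Z w)%:R) ^+ n)%:E <= B%:E)%E.
Proof.
move=> c0 K0 MB.
have h0 k : 0 <= (c + K * k%:R) ^+ n by rewrite exprn_ge0// addr_ge0// mulr_ge0.
rewrite (@ge0_integral_nat_rv _ _ _ _ _ (fun k => (c + K * k%:R) ^+ n))//.
apply: lime_le.
  by apply: is_cvg_nneseries => k _ _; rewrite lee_fin mulr_ge0// fine_ge0.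
by apply: nearW => N; rewrite sumEFin lee_fin; exact: MB.
Qed.

(** * Lipschitz functions, Markov's inequality and the tail bound *)

Lemma nat_lipschitz_le (R : realType) (K : R) (f : nat -> R) (k : nat) :
  nat_lipschitz K f -> `|f k - f 0%N| <= K * k%:R.
Proof.
move=> f_lip; elim: k => [|k IHk]; first by rewrite subrr normr0 mulr0.
rewrite (_ : f k.+1 - f 0%N = (f k.+1 - f k) + (f k - f 0%N)); last by ring.
rewrite -natr1 mulrDr mulr1 addrC [leRHS]addrC.
by rewrite (le_trans (ler_normD _ _))// addrC lerD// f_lip.
Qed.

(** The integral hypothesis amounts to E[K Z] <= delta, in the shape given by the moment bound with
    exponent 1; as |f(Z) - f(0)| <= K Z, it yields both integrability and the estimate. *)
Lemma nat_lipschitz_expectation (R : realType) (d : measure_display)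
    (T : measurableType d) (P : probability T R) (Z : {RV P >-> nat})
    (K c delta : R) (f : nat -> R) :
  0 <= c -> nat_lipschitz K f ->
  (\int[P]_w (c + K * (Z w)%:R)%:E <= (c + delta)%:E)%E ->
  exists2 e : R, ('E_P[f \o Z] = e%:E)%E & `|e - f 0%N| <= delta.
Proof.
move=> c0 f_lip intZ.
have mh h D := @measurable_nat_rv_comp _ _ _ P Z h D.
pose g w := (f (Z w) - f 0%N)%:E.
have mg : measurable_fun setT g by exact: mh (fun k => f k - f 0%N) _.
have mag : measurable_fun setT (fun w => `|g w|%E).
  exact: mh (fun k => `|f k - f 0%N|) _.
have intg : (\int[P]_w `|g w| <= delta%:E)%E.
  (* After adding c = E[c] to both sides, the pointwise bound c + |g| <= c + K Z suffices. *)
  rewrite -(@leeD2lE _ c%:E)// -EFinD; apply: le_trans intZ.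
  rewrite -[X in (X + _)%E]mule1 -(probability_setT P) -integral_cst//.
  rewrite -ge0_integralD//.
  apply: ge0_le_integral => //.
  - by move=> w _; rewrite adde_ge0// lee_fin.
  - exact: emeasurable_funD.
  - exact: mh (fun k => c + K * k%:R) _.
  - by move=> w _ /=; rewrite lee_fin lerD2l nat_lipschitz_le.
have ig : P.-integrable setT g.
  by apply/integrableP; split=> //; rewrite (le_lt_trans intg)// ltry.
have Eg : (\int[P]_w g w)%E \is a fin_num by exact: integrable_fin_num.
exists (fine (\int[P]_w g w)%E + f 0%N).
  rewrite EFinD fineK// expectation.unlock.
  rewrite -[in RHS](mule1 (f 0%N)%:E) -(probability_setT P) -integral_cst//.
  rewrite -integralD//; last exact: finite_measure_integrable_cst.
  by apply: eq_integral => w _; rewrite /g -EFinD subrK.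
rewrite addrK -lee_fin -abse_EFin fineK// (le_trans _ intg)//.
exact: le_abse_integral.
Qed.

Lemma ge0_markov_pow (R : realType) (d : measure_display)
    (T : measurableType d) (P : probability T R) (E : set T) (G : T -> R)
    (t B : R) (n : nat) :
  measurable E -> measurable_fun setT G -> (forall w, 0 <= G w) -> 0 < t ->
  (forall w, E w -> t <= G w) -> (\int[P]_w (G w ^+ n)%:E <= B%:E)%E ->
  (P E <= (B * t ^- n)%:E)%E.
Proof.
move=> mE mG G0 t0 EG intG.
have mGn D : measurable_fun D (fun w => (G w ^+ n)%:E).
  apply/measurable_EFinP; apply: (@measurable_funS _ _ _ _ setT) => //.
  exact: measurable_funX.
have Pfin : P E \is a fin_num by rewrite fin_num_measure.
rewrite -(fineK Pfin) lee_fin ler_pdivlMr ?exprn_gt0// mulrC.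
rewrite -lee_fin EFinM fineK// -integral_cst//; apply: le_trans intG.
apply: (@le_trans _ _ (\int[P]_(w in E) (G w ^+ n)%:E)%E).
  apply: ge0_le_integral => //.
  - by move=> w _; rewrite lee_fin exprn_ge0// ltW.
  - by move=> w Ew; rewrite lee_fin lerXn2r ?nnegrE ?EG// ltW.
by apply: ge0_subset_integral => // w _; rewrite lee_fin exprn_ge0.
Qed.

Theorem corollary2 (R : realType) (lambda : R) (lambda_gt0 : 0 < lambda)
    (Q : probability nat R) (Q_supp : Q [set 0%N] = 0%E)
    (L_gt1 : (1 < moment_order Q)%E)
    (d : measure_display) (T : measurableType d) (P : probability T R)
    (Z : {RV P >-> nat})
    (Z_law : is_compound_poisson lambda Q (distribution P Z))
    (K : R) (K_gt0 : 0 < K) (f : nat -> R) (f_lip : nat_lipschitz K f)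
    (n : nat) (n_gt0 : (0 < n)%N) (n_lt_L : (n%:R%:E < moment_order Q)%E)
    (t : R) (t_gt0 : 0 < t) :
  let A := expR (lambda * (\sum_(1 <= r < n.+1) 'C(n, r)%:R * qmoment Q r * K ^+ r)
                 - lambda * n%:R * ln K) in
  let B := 2 * `|f 0%N| + 2 * K * lambda * qmoment Q 1 + 1 in
  (P [set w | `|(f (Z w))%:E - 'E_P[f \o Z]| > t%:E]
     <= (A * B ^+ n * t ^- n)%:E)%E.
Proof.
rewrite /=; set b := 2 * `|f 0%N| + _ + 1.
have Q_fin r : (0 < r <= n)%N -> (moment Q r%:R < +oo)%E.
  move=> /andP[r0 rn]; apply: moment_lty => //.
  by apply: le_lt_trans n_lt_L; rewrite lee_fin ler_nat.
have Q1_fin : (moment Q 1 < +oo)%E by exact: (Q_fin 1%N).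
have q1_ge1 := qmoment1_ge1 Q_supp Q1_fin.
set q1 := qmoment Q 1 in q1_ge1 b *.
pose delta := K * lambda * q1.
have delta0 : 0 <= delta by rewrite !mulr_ge0 ?ltW// (lt_le_trans ltr01).
(* Here [delta] will bound the distance from f(0) to E[f(Z)], and the summand 1 makes c + delta at
   least 1, as [moment_recursion_bound] requires of its base. *)
pose c := 1 + delta.
have c0 : 0 <= c by rewrite addr_ge0.
(* Applied with k = 1 to control E[f(Z)], where the exponential factor is 1, and with k = n for
   Markov's inequality. *)
have int_pow k : (0 < k <= n)%N ->
    (\int[P]_w ((c + K * (Z w)%:R) ^+ k)%:E <= ((c + delta) ^+ k *
       expR (\sum_(2 <= r < k.+1) 'C(k, r)%:R * (lambda * K ^+ r * qmoment Q r)))%:E)%E.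
  move=> /andP[k0 kn]; apply: integral_pow_le (ltW K_gt0) _ => // N.
  have -> : c + delta = 1 + 2 * K * lambda * q1 by rewrite /c /delta; ring.
  apply: compound_poisson_truncated_moment_le (ltW K_gt0) _ _ => // r /andP[r0 rk].
  by apply: Q_fin; rewrite r0 (leq_trans rk).
have [e -> e_le] : exists2 e : R, ('E_P[f \o Z] = e%:E)%E & `|e - f 0%N| <= delta.
  apply: (@nat_lipschitz_expectation _ _ _ _ _ K c) => //.
  by have := int_pow 1%N n_gt0; rewrite big_geq// expR0 mulr1.
have G0 w : 0 <= c + K * (Z w)%:R by rewrite addr_ge0// mulr_ge0// ltW.
apply: le_trans (ge0_markov_pow _ _ G0 t_gt0 _ (int_pow n _)) _.
- exact: (@measurable_funPTI _ _ _ _ Z [set k | `|(f k)%:E - e%:E| > t%:E]%E).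
- by apply/measurable_EFinP; exact: (measurable_nat_rv_comp _ (fun k => c + K * k%:R)).
- move=> w; rewrite /= lte_fin => /ltW/le_trans; apply.
  have := nat_lipschitz_le (Z w) f_lip.
  have := ler_normD (f (Z w) - f 0%N) (f 0%N - e).
  rewrite -(distrC e) addrA subrK /c; lra.
- by rewrite n_gt0/=.
rewrite lee_fin ler_wpM2r ?invr_ge0 ?exprn_ge0 ?(ltW t_gt0)//.
rewrite [leLHS]mulrC; apply: ler_pM; rewrite ?expR_ge0 ?exprn_ge0 ?addr_ge0//.
  rewrite ler_expR [in leRHS]big_ltn// expr1 bin1.
  have -> : \sum_(2 <= r < n.+1) 'C(n, r)%:R * (lambda * K ^+ r * qmoment Q r) =
      lambda * \sum_(2 <= r < n.+1) 'C(n, r)%:R * qmoment Q r * K ^+ r.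
    by rewrite mulr_sumr; apply: eq_bigr => r _; ring.
  (* Since ln K < K <= q_1 K, the subtracted term of [A] is dominated by the r = 1 term. *)
  have lnK : lambda * n%:R * ln K <= lambda * n%:R * (q1 * K).
    rewrite ler_wpM2l ?mulr_ge0 ?(ltW lambda_gt0)//.
    rewrite (le_trans (ltW (ln_sublinear K_gt0)))//.
    by rewrite ler_peMl// ltW.
  rewrite -/q1; lra.
(* The two sides differ by exactly 2 |f(0)|. *)
have cb : c + delta <= b.
  by rewrite /b /c /delta; have := normr_ge0 (f 0%N); lra.
have cd0 : 0 <= c + delta by rewrite addr_ge0.
by rewrite lerXn2r ?nnegrE// (le_trans cd0).
Qed.
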